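(* Let $K$ be a field, $\lambda\in K$, and let $(A,\mu,1,\alpha,\beta)$ be a unitary BiHom-associative algebra over $K$ with $\alpha,\beta$ bijective. Let $\psi,\omega:A\to A$ be linear maps such that any two of $\alpha,\beta,\psi,\omega$ commute, $\psi(ab)=\psi(a)\psi(b)$, $\omega(ab)=\omega(a)\omega(b)$ for all $a,b\in A$, and $\psi(1)=1=\omega(1)$. Let $r=r^1\otimes r^2\in A\otimes A$ satisfy $(f\otimes f)(r)=r$ for each $f\in\{\alpha,\beta,\psi,\omega\}$, and put $$\Delta(a)=\Delta_r(a)=\omega\alpha^{-1}(a)r^1\otimes\beta(r^2)-\alpha(r^1)\otimes r^2\,\psi\beta^{-1}(a)-\lambda(\omega(a)\otimes 1).$$ Then $(A,\mu,\Delta_r,1,\alpha,\beta,\psi,\omega)$ is a quasitriangular unitary $\lambda$-infBH-bialgebra (that is, $r$ satisfies $r_{13}r_{12}-r_{12}r_{23}+r_{23}r_{13}=\lambda r_{13}$) if and only if $$(\Delta\otimes\psi)(r)=-r_{23}r_{13},$$ and equivalently if and only if $$(\omega\otimes\Delta)(r)=r_{13}r_{12}-\lambda(r_{13}+r_{12}).$$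
   Context: A BiHom-associative algebra $(A,\mu,\alpha,\beta)$ consists of a vector space $A$ and linear maps $\mu:A\otimes A\to A$ (written $ab$), $\alpha,\beta:A\to A$ with $\alpha\beta=\beta\alpha$, $\alpha(ab)=\alpha(a)\alpha(b)$, $\beta(ab)=\beta(a)\beta(b)$ and $\alpha(a)(bc)=(ab)\beta(c)$. It is unitary with unit $1$ if $\alpha(1)=1=\beta(1)$, $a1=\alpha(a)$, $1a=\beta(a)$ for all $a$. With $r=r^1\otimes r^2=\bar r^1\otimes\bar r^2$ (sums suppressed), in $A\otimes A\otimes A$: $r_{12}r_{23}=\alpha(r^1)\otimes r^2\bar r^1\otimes\beta(\bar r^2)$, $\;r_{13}r_{12}=\omega(r^1)\bar r^1\otimes\beta(\bar r^2)\otimes\alpha\psi(r^2)$, $\;r_{23}r_{13}=\beta\omega(r^1)\otimes\alpha(\bar r^1)\otimes\bar r^2\psi(r^2)$, $\;r_{13}=\omega(r^1)\otimes1\otimes\psi(r^2)$, $\;r_{12}=r\otimes1$, $\;r_{23}=1\otimes r$. The equation $r_{13}r_{12}-r_{12}r_{23}+r_{23}r_{13}=\lambda r_{13}$ is the $\lambda$-associative BiHom-Yang-Baxter equation ($\lambda$-abhYBe). In the setting of the claim, a quasitriangular unitary $\lambda$-infBH-bialgebra is the data $(A,\mu,1,\alpha,\beta,\psi,\omega,r)$ with $r$ a solution of the $\lambda$-abhYBe (its comultiplication being $\Delta_r$). *)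

(* Defs.v *)
From HB Require Import structures.
From mathcomp Require Import all_boot all_algebra.
From mathcomp Require Import generic_quotient ring_quotient sesquilinear.
From mathcomp Require Import boolp.
From mathcomp Require Import finmap monalg.

Set Implicit Arguments.
Unset Strict Implicit.
Unset Printing Implicit Defensive.

Import GRing.Theory.

Local Open Scope quotient_scope.
Local Open Scope ring_scope.

(* Locking keeps unification from unfolding into the quotient construction. *)
Fact tens_key : unit. Proof. exact: tt. Qed.

(* Tensor product over K of arbitrary, possibly infinite-dimensional, vector
   spaces: the free vector space {malg K[A * B]} on the set A * B modulo the
   subspace generated by the bilinearity relations. *)
Section Tensor.
Variables (K : fieldType) (A B : lmodType K).

Local Notation free := {malg K[(A * B)%type]}.
Local Notation gen a b := (<< ((a, b) : (A * B)%type) >> : free).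

Inductive bilin_span : free -> Prop :=
| span0 : bilin_span 0
| spanB x y : bilin_span x -> bilin_span y -> bilin_span (x - y)
| spanZ c x : bilin_span x -> bilin_span (c *: x)
| spanDl a a' b : bilin_span (gen (a + a') b - gen a b - gen a' b)
| spanDr a b b' : bilin_span (gen a (b + b') - gen a b - gen a b')
| spanZl c a b : bilin_span (gen (c *: a) b - c *: gen a b)
| spanZr c a b : bilin_span (gen a (c *: b) - c *: gen a b).

Definition bilin_rel : {pred free} := fun x => `[< bilin_span x >].

Lemma bilin_relP x : reflect (bilin_span x) (x \in bilin_rel).
Proof. exact: asboolP. Qed.

Lemma bilin_rel_zmod_closed : zmod_closed bilin_rel.
Proof.
split; first by apply/bilin_relP; exact: span0.
by move=> x y /bilin_relP hx /bilin_relP hy; apply/bilin_relP; exact: spanB.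
Qed.

HB.instance Definition _ :=
  GRing.isZmodClosed.Build free bilin_rel bilin_rel_zmod_closed.

Definition tensor : Type := Quotient.quot bilin_rel.

HB.instance Definition _ := GRing.Zmodule.on tensor.

Definition tens_pi (x : free) : tensor := \pi_(Quotient.quot bilin_rel) x.
Definition tens_repr (t : tensor) : free :=
  repr (t : Quotient.quot bilin_rel).

Definition tens : A -> B -> tensor :=
  locked_with tens_key (fun a b => tens_pi (gen a b)).

Lemma tens_def a b : tens a b = tens_pi (gen a b).
Proof. by rewrite /tens unlock. Qed.

Lemma tens_reprK t : tens_pi (tens_repr t) = t.
Proof. exact: reprK. Qed.

Lemma tens_piE x y : tens_pi x = tens_pi y <-> bilin_span (x - y).
Proof.
split=> [/eqP|h].
  rewrite /tens_pi -Quotient.idealrBE; exact: (bilin_relP _).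
apply/eqP; rewrite /tens_pi -Quotient.idealrBE; exact/bilin_relP.
Qed.

Lemma tens_pi_is_zmod_morphism : zmod_morphism tens_pi.
Proof. exact: (raddfB \pi_(Quotient.quot bilin_rel)). Qed.

HB.instance Definition _ :=
  GRing.isZmodMorphism.Build free tensor tens_pi tens_pi_is_zmod_morphism.

Definition tens_scale : K -> tensor -> tensor :=
  locked_with tens_key (fun c t => tens_pi (c *: tens_repr t)).

Lemma tens_scaleE c x : tens_scale c (tens_pi x) = tens_pi (c *: x).
Proof.
rewrite /tens_scale unlock; apply/tens_piE; rewrite -scalerBr.
apply: spanZ; apply/tens_piE.
exact: tens_reprK.
Qed.

Lemma tens_scaleA c d t :
  tens_scale c (tens_scale d t) = tens_scale (c * d) t.
Proof. by rewrite -[t]tens_reprK !tens_scaleE scalerA. Qed.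

Lemma tens_scale1 : left_id 1 tens_scale.
Proof. by move=> t; rewrite -[t]tens_reprK tens_scaleE scale1r. Qed.

Lemma tens_scaleDr : right_distributive tens_scale +%R.
Proof.
move=> c t u; rewrite -[t]tens_reprK -[u]tens_reprK -raddfD !tens_scaleE.
by rewrite scalerDr raddfD.
Qed.

Lemma tens_scaleDl t : {morph tens_scale^~ t : c d / c + d}.
Proof.
by move=> c d; rewrite -[t]tens_reprK !tens_scaleE scalerDl raddfD.
Qed.

HB.instance Definition _ := GRing.Zmodule_isLmodule.Build K tensor
  tens_scaleA tens_scale1 tens_scaleDr tens_scaleDl.

Lemma tens_pi_is_scalable : scalable tens_pi.
Proof. by move=> c x; rewrite -tens_scaleE. Qed.

HB.instance Definition _ :=
  GRing.isScalable.Build K free tensor *:%R tens_pi tens_pi_is_scalable.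

Lemma tens_bilinear : bilinear_for *:%R *:%R tens.
Proof.
have D a a' b : tens (a + a') b = tens a b + tens a' b.
  rewrite !tens_def -raddfD; apply/tens_piE; rewrite opprD addrA; exact: spanDl.
have D' a b b' : tens a (b + b') = tens a b + tens a b'.
  rewrite !tens_def -raddfD; apply/tens_piE; rewrite opprD addrA; exact: spanDr.
have Z c a b : tens (c *: a) b = c *: tens a b.
  rewrite !tens_def -linearZ; apply/tens_piE; exact: spanZl.
have Z' c a b : tens a (c *: b) = c *: tens a b.
  rewrite !tens_def -linearZ; apply/tens_piE; exact: spanZr.
by split=> [b c a a'|a c b b']; rewrite ?D ?Z ?D' ?Z'.
Qed.

HB.instance Definition _ := bilinear_isBilinear.Build K A B tensor _ _
  tens tens_bilinear.

Lemma tensE (t : tensor) : exists s : seq (A * B),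
  t = \sum_(p <- s) tens p.1 p.2.
Proof.
rewrite -[t]tens_reprK [tens_repr t]monalgE raddf_sum /=.
exists [seq ((tens_repr t)@_p *: p.1, p.2) | p <- msupp (tens_repr t)].
rewrite big_map; apply: eq_bigr => -[a b] _ /=.
rewrite linearZl_LR /= tens_def -linearZ; congr tens_pi.
by apply/malgP=> k; rewrite mcoeffZ !mcoeffU mulrnAr mulr1.
Qed.

(* The linear map sending a (x) b to f a b. It is meaningful only for bilinear
   f, and then independent of the representative: see tlift_tens. *)
Definition tlift (V : lmodType K) : (A -> B -> V) -> tensor -> V :=
  locked_with tens_key (fun f t =>
    \sum_(p <- msupp (tens_repr t)) (tens_repr t)@_p *: f p.1 p.2).

Lemma tlift_def (V : lmodType K) (f : A -> B -> V) t : tlift f t =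
  \sum_(p <- msupp (tens_repr t)) (tens_repr t)@_p *: f p.1 p.2.
Proof. by rewrite /tlift unlock. Qed.

Section Lift.
Variables (V : lmodType K) (f : A -> B -> V).

Let flift (x : free) : V := \sum_(p <- msupp x) x@_p *: f p.1 p.2.

Let fliftw (x : free) (d : {fset (A * B)%type}) : (msupp x `<=` d)%fset ->
  flift x = \sum_(p <- d) x@_p *: f p.1 p.2.
Proof.
move=> sxd; rewrite /flift (big_fset_incl _ sxd) // => p _ /mcoeff_outdom ->.
by rewrite scale0r.
Qed.

Let flift_linear : linear flift.
Proof.
move=> c x y; pose d := (msupp (c *: x + y) `|` msupp x `|` msupp y)%fset.
rewrite (@fliftw _ d); last by rewrite /d -fsetUA fsubsetUl.
rewrite (@fliftw x d); last first.
  by rewrite /d fsetUAC fsubsetUr.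
rewrite (@fliftw y d); last by rewrite /d fsubsetUr.
rewrite scaler_sumr -big_split; apply: eq_bigr => p _ /=.
by rewrite mcoeffD mcoeffZ scalerDl scalerA.
Qed.

Let fliftB x y : flift (x - y) = flift x - flift y.
Proof. by have := flift_linear (-1) y x; rewrite !scaleN1r ![- _ + _]addrC. Qed.

Let flift0 : flift 0 = 0.
Proof. by rewrite -[X in flift X](subrr 0) fliftB subrr. Qed.

Let fliftZ c x : flift (c *: x) = c *: flift x.
Proof. by rewrite -[c *: x]addr0 flift_linear flift0 addr0. Qed.

Let fliftU a b : flift (gen a b) = f a b.
Proof.
by rewrite /flift msuppU oner_eq0 big_seq_fset1 mcoeffUU scale1r.
Qed.

Hypothesis bilf : bilinear_for *:%R *:%R f.

Let flift_span x : bilin_span x -> flift x = 0.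
Proof.
have [fl fr] := bilf.
have f0l b : f 0 b = 0.
  by have := fl b (-1) 0 0; rewrite /= scaler0 addr0 scaleN1r addNr.
have f0r a : f a 0 = 0.
  by have := fr a (-1) 0 0; rewrite /= scaler0 addr0 scaleN1r addNr.
elim=> {x} [|x y _ hx _ hy|c x _ hx|a a' b|a b b'|c a b|c a b].
- exact: flift0.
- by rewrite fliftB hx hy subrr.
- by rewrite fliftZ hx scaler0.
- have := fl b 1 a a'; rewrite /= !scale1r => e.
  by rewrite !fliftB !fliftU e (addrC (f a b)) addrK subrr.
- have := fr a 1 b b'; rewrite /= !scale1r => e.
  by rewrite !fliftB !fliftU e (addrC (f a b)) addrK subrr.
- by rewrite fliftB fliftZ !fliftU -[c *: a]addr0 (fl b) /= f0l addr0 subrr.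
- by rewrite fliftB fliftZ !fliftU -[c *: b]addr0 (fr a) /= f0r addr0 subrr.
Qed.

Let tliftE x : tlift f (tens_pi x) = flift x.
Proof.
rewrite tlift_def -/(flift _).
apply/eqP; rewrite -subr_eq0 -fliftB; apply/eqP/flift_span/tens_piE.
exact: tens_reprK.
Qed.

Lemma tlift_tens a b : tlift f (tens a b) = f a b.
Proof. by rewrite tens_def tliftE fliftU. Qed.

Lemma tlift_linear : linear (tlift f).
Proof.
move=> c t u; rewrite -[t]tens_reprK -[u]tens_reprK -linearP !tliftE.
exact: flift_linear.
Qed.

End Lift.

End Tensor.

Notation "a ⊗ b" := (tens a b) (at level 40, left associativity) : ring_scope.

Definition tmap (K : fieldType) (A B C D : lmodType K)
    (f : A -> C) (g : B -> D) : tensor A B -> tensor C D :=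
  tlift (fun a b => f a ⊗ g b).

Definition tassoc (K : fieldType) (A B C : lmodType K) :
    tensor A (tensor B C) -> tensor (tensor A B) C :=
  tlift (fun a t => tlift (fun b c => a ⊗ b ⊗ c) t).

Section BiHom.
Variables (K : fieldType) (A : lmodType K).

Local Notation A2 := (tensor A A).
Local Notation A3 := (tensor (tensor A A) A).

Definition multiplicative_map (mu : A2 -> A) (f : A -> A) : Prop :=
  forall a b, f (mu (a ⊗ b)) = mu (f a ⊗ f b).

Definition commuting_maps (f g : A -> A) : Prop := forall a, f (g a) = g (f a).

Definition invariant_under (f : A -> A) (r : A2) : Prop := tmap f f r = r.

Record bihom_associative (mu : {linear A2 -> A})
    (alpha beta : {linear A -> A}) : Prop := {
  bihom_comm : commuting_maps alpha beta;
  bihom_alphaM : multiplicative_map mu alpha;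
  bihom_betaM : multiplicative_map mu beta;
  bihom_assoc : forall a b c,
    mu (alpha a ⊗ mu (b ⊗ c)) = mu (mu (a ⊗ b) ⊗ beta c)
}.

Record unitary_bihom_associative (mu : {linear A2 -> A}) (e : A)
    (alpha beta : {linear A -> A}) : Prop := {
  unitary_assoc : bihom_associative mu alpha beta;
  unitary_alpha1 : alpha e = e;
  unitary_beta1 : beta e = e;
  unitary_mulr1 : forall a, mu (a ⊗ e) = alpha a;
  unitary_mul1r : forall a, mu (e ⊗ a) = beta a
}.

Variables (mu : {linear A2 -> A}) (e : A).
Variables (alpha beta psi omega : {linear A -> A}).

(* The sum of f r^1 r^2 s^1 s^2 over r = r^1 (x) r^2 and s = s^1 (x) s^2. *)
Definition tlift2 (V : lmodType K) (f : A -> A -> A -> A -> V) (r s : A2) : V :=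
  tlift (fun r1 r2 => tlift (fun s1 s2 => f r1 r2 s1 s2) s) r.

Definition r12 (r : A2) : A3 := r ⊗ e.

Definition r13 (r : A2) : A3 :=
  tlift (fun r1 r2 => omega r1 ⊗ e ⊗ psi r2) r.

Definition r12r23 (r : A2) : A3 :=
  tlift2 (fun r1 r2 s1 s2 => alpha r1 ⊗ mu (r2 ⊗ s1) ⊗ beta s2) r r.

Definition r13r12 (r : A2) : A3 :=
  tlift2 (fun r1 r2 s1 s2 =>
    mu (omega r1 ⊗ s1) ⊗ beta s2 ⊗ alpha (psi r2)) r r.

Definition r23r13 (r : A2) : A3 :=
  tlift2 (fun r1 r2 s1 s2 =>
    beta (omega r1) ⊗ alpha s1 ⊗ mu (s2 ⊗ psi r2)) r r.

Definition abhYBe (lambda : K) (r : A2) : Prop :=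
  r13r12 r - r12r23 r + r23r13 r = lambda *: r13 r.

(* alphaV and betaV stand for the inverses of alpha and beta. *)
Definition Delta_r (alphaV betaV : A -> A) (lambda : K) (r : A2) (a : A) : A2 :=
  tlift (fun r1 r2 => mu (omega (alphaV a) ⊗ r1) ⊗ beta r2) r
  - tlift (fun r1 r2 => alpha r1 ⊗ mu (r2 ⊗ psi (betaV a))) r
  - lambda *: (omega a ⊗ e).

Record quasitriangular (alphaV betaV : A -> A) (lambda : K)
    (Delta : A -> A2) (r : A2) : Prop := {
  quasitriangular_alg : unitary_bihom_associative mu e alpha beta;
  quasitriangular_comul : forall a, Delta a = Delta_r alphaV betaV lambda r a;
  quasitriangular_ybe : abhYBe lambda r
}.

End BiHom.

(* Main.v *)
(* Expanding Delta_r on one leg of r turns each of its terms into a double sum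
   over r (x) r.  The inverses of alpha and beta are absorbed by the invariance
   of the outer copy of r, which gives unconditionally
     (Delta (x) psi)(r) = r13 r12 - r12 r23 - lambda r13,
     (omega (x) Delta)(r) = r12 r23 - r23 r13 - lambda r12,
   so that each of the two identities is a rearrangement of the lambda-abhYBe. *)
Require Import Defs.
From HB Require Import structures.
From mathcomp Require Import all_boot all_algebra.
From mathcomp Require Import sesquilinear.

Set Implicit Arguments.
Unset Strict Implicit.
Unset Printing Implicit Defensive.

Import GRing.Theory.

Local Open Scope ring_scope.

Section TensorLift.
Variables (K : fieldType) (A B : lmodType K).

Lemma tensPl c (a a' : A) (b : B) : (c *: a + a') ⊗ b = c *: (a ⊗ b) + a' ⊗ b.
Proof. by rewrite linearPl. Qed.

Lemma tensPr c (a : A) (b b' : B) :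
  a ⊗ (c *: b + b') = c *: (a ⊗ b) + a ⊗ b'.
Proof. by rewrite linearPr. Qed.

(** For any [f], bilinear or not, [tlift f t] is a finite sum over the support of a fixed
    representative of [t], with coefficients independent of [f]. Identities between integrands
    therefore transfer term by term, here and in the lemmas that follow up to [tlift_tmap]. *)
Lemma eq_tlift (V : lmodType K) (f g : A -> B -> V) t :
  f =2 g -> tlift f t = tlift g t.
Proof.
by move=> fg; rewrite !tlift_def; apply: eq_bigr => p _; rewrite fg.
Qed.

Lemma tliftBf (V : lmodType K) (f g : A -> B -> V) t :
  tlift (fun a b => f a b - g a b) t = tlift f t - tlift g t.
Proof.
by rewrite !tlift_def -sumrB; apply: eq_bigr => p _; rewrite scalerBr.
Qed.

Lemma tliftZf (V : lmodType K) c (f : A -> B -> V) t :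
  tlift (fun a b => c *: f a b) t = c *: tlift f t.
Proof.
rewrite !tlift_def scaler_sumr; apply: eq_bigr => p _.
by rewrite !scalerA mulrC.
Qed.

Lemma linear_tlift (V W : lmodType K) (L : V -> W) (f : A -> B -> V) t :
  linear L -> L (tlift f t) = tlift (fun a b => L (f a b)) t.
Proof.
(* [L] is a bare function, so that sections such as [fun t => t ⊗ b] can be passed. It gets its
   linear structure here, for [linear_sum]. *)
move=> linL; pose lin := GRing.isLinear.Build K V W *:%R L linL.
pose L' : {linear V -> W} := HB.pack L lin.
rewrite !tlift_def -[L]/(L' : V -> W) linear_sum.
by apply: eq_bigr => p _; rewrite linearZ.
Qed.

(** In a double sum over two copies of [r], this reduces bilinearity in the outer copy to
    bilinearity with the inner legs fixed; [tlift_invariant] asks for it. *)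
Lemma bilinear_tlift (U U' V : lmodType K) (f : U -> U' -> A -> B -> V) t :
  (forall a b, bilinear_for *:%R *:%R (fun u u' => f u u' a b)) ->
  bilinear_for *:%R *:%R (fun u u' => tlift (f u u') t).
Proof.
move=> bf; split=> [u'|u] c x y /=;
  rewrite !tlift_def scaler_sumr -big_split; apply: eq_bigr => p _ /=.
  by rewrite (bf p.1 p.2).1 /= scalerDr !scalerA mulrC.
by rewrite (bf p.1 p.2).2 /= scalerDr !scalerA mulrC.
Qed.

(** The chosen representative of [tmap g h t] is unrelated to that of [t], so the comparison goes
    through the universal property, which rests on bilinearity of [f]. *)
Lemma tlift_tmap (C D V : lmodType K) (g : {linear A -> C})
    (h : {linear B -> D}) (f : C -> D -> V) t :
  bilinear_for *:%R *:%R f ->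
  tlift f (tmap g h t) = tlift (fun a b => f (g a) (h b)) t.
Proof.
move=> bf; rewrite /tmap (linear_tlift _ _ (tlift_linear bf)).
by apply: eq_tlift => a b; rewrite tlift_tens.
Qed.

End TensorLift.

(** Fubini for two finite sums. It allows the two copies of [r] in a product such as [r12r23] to
    swap roles. *)
Lemma tlift_exchange (K : fieldType) (A B C D V : lmodType K)
    (f : A -> B -> C -> D -> V) t u :
  tlift (fun a b => tlift (f a b) u) t =
  tlift (fun c d => tlift (fun a b => f a b c d) t) u.
Proof.
rewrite tlift_def.
under eq_bigr => p _ do rewrite tlift_def scaler_sumr.
rewrite exchange_big tlift_def; apply: eq_bigr => q _ /=.
rewrite tlift_def scaler_sumr; apply: eq_bigr => p _.
by rewrite !scalerA mulrC.
Qed.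

Section Tassoc.
Variables (K : fieldType) (A B C : lmodType K).

Lemma bilinear_tens3 (a : A) :
  bilinear_for *:%R *:%R (fun (b : B) (c : C) => a ⊗ b ⊗ c).
Proof. by split=> [c|b] k x y /=; rewrite ?tensPr ?tensPl ?tensPr. Qed.

Lemma bilinear_tassoc : bilinear_for *:%R *:%R
  (fun (a : A) (t : tensor B C) => tlift (fun b c => a ⊗ b ⊗ c) t).
Proof.
split=> [t|a] k x y /=; last exact: (tlift_linear (bilinear_tens3 a)).
rewrite !tlift_def scaler_sumr -big_split; apply: eq_bigr => p _ /=.
by rewrite !tensPl scalerDr !scalerA mulrC.
Qed.

Lemma tassoc_linear : linear (@tassoc K A B C).
Proof. exact: (tlift_linear bilinear_tassoc). Qed.

Lemma tassoc_tens (a : A) (b : B) (c : C) : tassoc (a ⊗ (b ⊗ c)) = a ⊗ b ⊗ c.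
Proof.
rewrite /tassoc (tlift_tens bilinear_tassoc).
exact: (tlift_tens (bilinear_tens3 a)).
Qed.

End Tassoc.

Section Coproduct.
Variables (K : fieldType) (A : lmodType K).

(** A change of variables in the sum over [r]: taking [g] to be [alpha] or [beta] makes the inverse
    map inside [Delta_r] cancel. *)
Lemma tlift_invariant (V : lmodType K) (f : A -> A -> V) (g : {linear A -> A})
    (r : tensor A A) :
  bilinear_for *:%R *:%R f -> invariant_under g r ->
  tlift f r = tlift (fun a b => f (g a) (g b)) r.
Proof. by move=> bf gr; rewrite -{1}gr tlift_tmap. Qed.

Variables (mu : {linear tensor A A -> A}) (e : A).
Variables (alpha beta psi omega : {linear A -> A}) (alphaV betaV : A -> A).
Variables (lambda : K) (r : tensor A A).

Hypotheses (alphaK : cancel alpha alphaV) (alphaVK : cancel alphaV alpha).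
Hypotheses (betaK : cancel beta betaV) (betaVK : cancel betaV beta).
Hypotheses (r_alpha : invariant_under alpha r) (r_beta : invariant_under beta r).
Hypotheses (r_psi : invariant_under psi r) (r_omega : invariant_under omega r).

Local Notation Delta :=
  (Delta_r mu e alpha beta psi omega alphaV betaV lambda r).

Let alphaVP : linear alphaV.
Proof. exact: GRing.can2_linear alphaK alphaVK. Qed.

Let betaVP : linear betaV.
Proof. exact: GRing.can2_linear betaK betaVK. Qed.

Lemma tmap_Delta_r (alpha_psi : commuting_maps alpha psi)
    (beta_psi : commuting_maps beta psi) :
  tmap Delta psi r =
  r13r12 mu alpha beta psi omega r - r12r23 mu alpha beta r
  - lambda *: r13 e psi omega r.
Proof.
have tensl (b : A) : linear (fun t : tensor A A => t ⊗ b).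
  by move=> k x y; exact: tensPl.
transitivity (tlift (fun a b =>
    tlift (fun s1 s2 => mu (omega (alphaV a) ⊗ s1) ⊗ beta s2 ⊗ psi b) r
    - tlift (fun s1 s2 => alpha s1 ⊗ mu (s2 ⊗ psi (betaV a)) ⊗ psi b) r
    - lambda *: (omega a ⊗ e ⊗ psi b)) r).
  apply: eq_tlift => a b; rewrite /Delta_r !linearBl /= linearZl_LR /=.
  by rewrite !(linear_tlift _ _ (tensl (psi b))).
rewrite !tliftBf tliftZf; congr (_ - _ - _).
(* Replacing both outer legs by their images under [alpha] cancels [alphaV] and turns [psi b] into
   [psi (alpha b)], the last leg of [r13r12]. *)
- rewrite (tlift_invariant _ r_alpha); last first.
    apply: bilinear_tlift => s1 s2; split=> [a|a] k x y /=.
      by rewrite alphaVP linearP tensPl linearP !tensPl.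
    by rewrite linearP tensPr.
  apply: eq_tlift => a b; apply: eq_tlift => s1 s2.
  by rewrite alphaK alpha_psi.
- rewrite (tlift_invariant _ r_beta); last first.
    apply: bilinear_tlift => s1 s2; split=> [a|a] k x y /=.
      by rewrite betaVP linearP tensPr linearP tensPr tensPl.
    by rewrite linearP tensPr.
  (* The legs [a], [b] of the outer copy correspond to the second copy of [r] in [r12r23]. That copy
     is moved outside, and invariance supplies the [psi] that both legs carry on the left. *)
  rewrite [RHS]tlift_exchange [RHS](tlift_invariant _ r_psi); last first.
    apply: bilinear_tlift => s1 s2; split=> [a|a] k x y /=.
      by rewrite tensPr linearP tensPr tensPl.
    by rewrite linearP tensPr.
  apply: eq_tlift => a b; apply: eq_tlift => s1 s2.
  by rewrite betaK beta_psi.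
Qed.

Lemma tassoc_tmap_Delta_r (alpha_omega : commuting_maps alpha omega)
    (beta_omega : commuting_maps beta omega) :
  tassoc (tmap omega Delta r) =
  r12r23 mu alpha beta r - r23r13 mu alpha beta psi omega r
  - lambda *: r12 e r.
Proof.
have tassocr (a : A) : linear (fun t : tensor A A => tassoc (a ⊗ t)).
  by move=> k x y; rewrite tensPr; exact: tassoc_linear.
transitivity (tlift (fun a b =>
    tlift (fun s1 s2 => omega a ⊗ mu (omega (alphaV b) ⊗ s1) ⊗ beta s2) r
    - tlift (fun s1 s2 => omega a ⊗ alpha s1 ⊗ mu (s2 ⊗ psi (betaV b))) r
    - lambda *: (omega a ⊗ omega b ⊗ e)) r).
  rewrite (linear_tlift _ _ (@tassoc_linear K A A A)).
  apply: eq_tlift => a b; rewrite /Delta_r.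
  (* Packing [t |-> tassoc (omega a ⊗ t)] as a linear map lets it distribute over the three terms of
     [Delta_r]. *)
  pose lin := GRing.isLinear.Build K _ _ *:%R _ (tassocr (omega a)).
  pose L : {linear tensor A A -> tensor (tensor A A) A} :=
    HB.pack (fun _ => _) lin.
  rewrite -[LHS]/(L _) !linearB linearZ /= tassoc_tens.
  rewrite !(linear_tlift _ _ (tassocr (omega a))).
  by congr (_ - _ - _); apply: eq_tlift => s1 s2; rewrite tassoc_tens.
rewrite !tliftBf tliftZf; congr (_ - _ - _).
- rewrite (tlift_invariant _ r_alpha); last first.
    apply: bilinear_tlift => s1 s2; split=> [b|a] k x y /=.
      by rewrite linearP !tensPl.
    by rewrite alphaVP linearP tensPl linearP tensPr tensPl.
  (* The left side carries [omega] on both outer legs, from [tmap] and from [Delta_r]; in [r12r23]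
     it appears by invariance of the first copy. *)
  rewrite [RHS](tlift_invariant _ r_omega); last first.
    apply: bilinear_tlift => s1 s2; split=> [b|a] k x y /=.
      by rewrite linearP !tensPl.
    by rewrite tensPl linearP tensPr tensPl.
  apply: eq_tlift => a b; apply: eq_tlift => s1 s2.
  by rewrite alphaK alpha_omega.
- rewrite (tlift_invariant _ r_beta); last first.
    apply: bilinear_tlift => s1 s2; split=> [b|a] k x y /=.
      by rewrite linearP !tensPl.
    by rewrite betaVP linearP tensPr linearP tensPr.
  apply: eq_tlift => a b; apply: eq_tlift => s1 s2.
  by rewrite betaK beta_omega.
(* The third term is [(omega ⊗ omega)(r) ⊗ e], which is [r12] by invariance. *)
- congr (_ *: _); rewrite /r12 -{2}r_omega.
  by rewrite (linear_tlift (L := fun t => t ⊗ e)) // => k x y; rewrite tensPl.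
Qed.

End Coproduct.

Theorem proposition3p10 (K : fieldType) (lambda : K) (A : lmodType K)
    (mu : {linear tensor A A -> A}) (e : A)
    (alpha beta psi omega : {linear A -> A}) (alphaV betaV : A -> A)
    (r : tensor A A)
    (hA : unitary_bihom_associative mu e alpha beta)
    (alphaK : cancel alpha alphaV) (alphaVK : cancel alphaV alpha)
    (betaK : cancel beta betaV) (betaVK : cancel betaV beta)
    (alpha_psi : commuting_maps alpha psi)
    (alpha_omega : commuting_maps alpha omega)
    (beta_psi : commuting_maps beta psi)
    (beta_omega : commuting_maps beta omega)
    (psi_omega : commuting_maps psi omega)
    (psiM : multiplicative_map mu psi) (omegaM : multiplicative_map mu omega)
    (psi1 : psi e = e) (omega1 : omega e = e)
    (r_alpha : invariant_under alpha r) (r_beta : invariant_under beta r)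
    (r_psi : invariant_under psi r) (r_omega : invariant_under omega r) :
  let Delta := Delta_r mu e alpha beta psi omega alphaV betaV lambda r in
  let qt :=
    quasitriangular mu e alpha beta psi omega alphaV betaV lambda Delta r in
  (qt <->
     tmap Delta psi r = - r23r13 mu alpha beta psi omega r) /\
  (qt <->
     tassoc (tmap omega Delta r) =
       r13r12 mu alpha beta psi omega r
       - lambda *: (r13 e psi omega r + r12 e r)).
Proof.
move=> Delta qt.
(* The algebra axioms are [hA], and the comultiplication is [Delta_r] by definition. *)
have qtE : qt <-> abhYBe mu e alpha beta psi omega lambda r.
  by split=> [[]|ybe] //; split.
have -> : tmap Delta psi r =
    r13r12 mu alpha beta psi omega r - r12r23 mu alpha beta r
    - lambda *: r13 e psi omega r by exact: tmap_Delta_r.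
have -> : tassoc (tmap omega Delta r) =
    r12r23 mu alpha beta r - r23r13 mu alpha beta psi omega r
    - lambda *: r12 e r by exact: tassoc_tmap_Delta_r.
rewrite qtE /abhYBe scalerDr.
(* Only abelian group arithmetic remains: [x - y + z = w] is compared with [x - y - w = - z] and
   with [y - z - v = x - (w + v)]. *)
move: (r13r12 _ _ _ _ _ _) (r12r23 _ _ _ _) (r23r13 _ _ _ _ _ _) => x y z.
move: (_ *: r13 _ _ _ _) (_ *: r12 _ _) => w v; split; split=> [<-|ybe].
- by rewrite opprD addNKr.
- by rewrite -[x - y](subrK w) ybe addrAC addNr add0r.
- by rewrite opprD addrA -[x - y + z]addrA opprD addNKr opprD opprK.
(* The term [v], from [r12], occurs on both sides and cancels. *)
- have /addIr xw : y - z - v = x - w - v by rewrite ybe opprD addrA.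
  by rewrite -addrA (addrC (- y)) -opprB xw subKr.
Qed.
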